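(* Let $(A,\gamma_A)$ be a $\mathrm{cCx}_\infty$-algebra (over $\mathbb R$) with bar construction $\hat{\mathrm B}_\iota A$. Endow $\mathbb C$ with its $\mathrm{cCx}_\infty$-algebra structure $\gamma_{\mathbb C}$ and with its trivial $A$-module structure $\gamma^A_{\mathbb C}$. There is an isomorphism of $\mathbb R$-modules $$Z^0_{AQ}((A,\gamma_A),(\mathbb C,\gamma^A_{\mathbb C}))\cong\infty\text{-}\mathrm{mor}((A,\gamma_A),(\mathbb C,\gamma_{\mathbb C})),$$ where $Z^0_{AQ}((A,\gamma_A),(\mathbb C,\gamma^A_{\mathbb C}))=\ker\big(\partial_\tau:\mathrm{Hom}^0(\hat{\mathrm B}_\iota A,\mathbb C)\to\mathrm{Hom}^1(\hat{\mathrm B}_\iota A,\mathbb C)\big)$.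
   Context: **Base objects.** Everything is over $\mathbb R$; cohomological degrees; Koszul sign rule. A gr-dg module is a graded module with complete decreasing filtration $M=F_0M\supseteq F_1M\supseteq\cdots$ and a filtered endomorphism $d$ of degree $+1$ with $d^2(F_pM)\subseteq F_{p+1}M$. Maps are filtered; sums, tensor and composite products completed. $s$ has cohomological degree $-1$. $\mathbb C$ is in degree $0$ with $F_1\mathbb C=0$. $\mathrm{Hom}^n$ = filtered $\mathbb R$-linear maps of degree $n$. **$\mathrm{cCx}^{¡}$.** Curved cooperad with basis in arity $n\ge0$ the elements $\jmath^c_{k_1,\dots,k_n}$, $k_j\ge0$, of degree $-(k_1+\cdots+k_n)$ ($\jmath^c_\emptyset$ for $n=0$), $S_n$ permuting indices with Koszul signs; $F_1=\mathbb R\jmath^c_\emptyset$, $F_2=0$; zero predifferential; counit $\varepsilon$ dual to $\jmath^c_0$; gr-coaugmentation $\eta(1)=\jmath^c_0$; curvature $\theta^c(\jmath_2^c)=1$, zero on other basis elements; $$\Delta(\jmath^c_{k_1,\dots,k_n})=\sum\tfrac1{p!}\beta^\sigma_{k',k''}\big(\jmath^c_{l'_1,\dots,l'_p};\jmath^c_{k''_{\sigma(1)},\dots,k''_{\sigma(q_1)}},\jmath^c_{k''_{\sigma(q_1+1)},\dots,k''_{\sigma(q_1+q_2)}},\dots\big)^{\sigma^{-1}}$$ over $p\ge0$, $q_1+\cdots+q_p=n$ ($q_i\ge0$), $\sigma\in Sh_{q_1,\dots,q_p}$, $k'_j+k''_j=k_j$, with $l'_i=k'_{\sigma(q_1+\cdots+q_{i-1}+1)}+\cdots+k'_{\sigma(q_1+\cdots+q_i)}$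 and $\beta^\sigma_{k',k''}=\mathrm{sgn}_{k_1,\dots,k_n}\sigma\cdot(-1)^{\sum_ik''_{\sigma(i)}(k'_{\sigma(i+1)}+\cdots+k'_{\sigma(n)})}\cdot\prod_i\alpha_{k'_{\sigma(q_1+\cdots+q_{i-1}+1)},\dots,k'_{\sigma(q_1+\cdots+q_i)}}$; $\mathrm{sgn}_{k_1,\dots,k_n}\sigma$ is the sign of $\sigma$ restricted to indices $j$ with $k_j$ odd; $\alpha_{k_1,\dots,k_q}=\sum_{\sigma'\in Sh_{k_1,\dots,k_q}}\mathrm{sgn}\,\sigma'$, $\alpha_{0,\dots,0}=1$. $\Delta_{(1)}$ is the infinitesimal decomposition. **$\mathrm{cCx}_\infty$ and algebras.** $\mathrm{cCx}_\infty=\hat\Omega\,\mathrm{cCx}^{¡}$ is the free complete operad on $s^{-1}\overline{\mathrm{cCx}^{¡}}$, $\overline{\mathrm{cCx}^{¡}}=\ker\varepsilon$, with predifferential the derivation extending $s^{-1}c\mapsto-\theta^c(c)-\sum(-1)^{|c'|}s^{-1}c'\circ_is^{-1}c''$ ($\bar\Delta_{(1)}(c)=\sum c'\circ_ic''$, $\Delta_{(1)}$ projected to $\overline{\mathrm{cCx}^{¡}}$) and curvature $\theta=-s^{-2}\bar\Delta_{(1)}(\eta(1))$; $\iota:\mathrm{cCx}^{¡}\to\overline{\mathrm{cCx}^{¡}}\cong s^{-1}\overline{\mathrm{cCx}^{¡}}\to\mathrm{cCx}_\infty$. An algebra is a gr-dg module $(A,d_A)$ with a compatible operad action $\gamma_A$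 and $d_A^2=\gamma_A(\theta\circ\mathrm{id})$. $\gamma_{\mathbb C}$: $s^{-1}\jmath_1^c$ acts on $\mathbb C$ as multiplication by $i$, all other generators as $0$, $d_{\mathbb C}=0$. $\mathrm{cCx}_\infty(A,N)$ is the part of $\mathrm{cCx}_\infty(A\oplus N)$ linear in $N$; $\gamma^A_{\mathbb C}:\mathrm{cCx}_\infty(A,\mathbb C)\to\mathbb C$ is the $A$-module structure in which the identity operation acts as the identity, $s^{-1}\jmath_1^c$ as multiplication by $i$ and all other generators as $0$. **Bar construction, $\infty$-morphisms.** $\hat{\mathrm B}_\iota A=(\mathrm{cCx}^{¡}(A),d_b=\mathrm{id}\circ'd_A+d^r_\iota)$, with $\mathrm{id}\circ'd_A$ applying $d_A$ to one input at a time and $d^r_\iota$ the coderivation with projection $\gamma_A(\iota\circ\mathrm{id}_A):\mathrm{cCx}^{¡}(A)\to A$. $\infty\text{-}\mathrm{mor}(A,B)$ is the set of morphisms of $\mathrm{cCx}^{¡}$-coalgebras $\hat{\mathrm B}_\iota A\to\hat{\mathrm B}_\iota B$ commuting with predifferentials (equivalently, of algebraic twisting morphisms $\varphi:\hat{\mathrm B}_\iota A\to B$: degree $0$ filtered maps with $d_B\varphi-\varphi d_b+\gamma_B(\iota\circ\varphi)\Delta_{\hat{\mathrm B}_\iota A}=0$, with $\Delta_{\hat{\mathrm B}_\iota A}=\Delta\circ\mathrm{id}_A$). **Differential.** $\partial_\tau f=-(-1)^{|f|}fd_b+\delta^l_\iota(f)$, with $\delta^l_\iota(f)$ the composite $\mathrm{cCx}^{¡}(A)\xrightarrow{\Delta_{(1)}\circ\mathrm{id}}(\mathrm{cCx}^{¡}\hat\circ_{(1)}\mathrm{cCx}^{¡})(A)\xrightarrow{(\iota\circ_{(1)}\mathrm{id})\circ\mathrm{id}}(\mathrm{cCx}_\infty\hat\circ_{(1)}\mathrm{cCx}^{¡})(A)\to\mathrm{cCx}_\infty(A,\mathrm{cCx}^{¡}(A))\xrightarrow{(-1)^{|f|}\mathrm{id}(\mathrm{id}_A,f)}\mathrm{cCx}_\infty(A,\mathbb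 C)\xrightarrow{\gamma^A_{\mathbb C}}\mathbb C$.
   Formalization: The sign of θ^c in the predifferential of cCx_∞ is taken as +θ^c(c) instead of −θ^c(c), since with the printed sign s^{-1}j_2 forces −1+i²=−2 to act as 0 on C, so (C,γ_C) would not be a cCx_∞-algebra. *)

(* Defs.v *)
From HB Require Import structures.
From mathcomp Require Import all_boot all_order perm all_algebra.
From mathcomp Require Import boolp classical_sets reals.
From mathcomp Require Import complex.

Set Implicit Arguments.
Unset Strict Implicit.
Unset Printing Implicit Defensive.

Import GRing.Theory.

Local Open Scope classical_set_scope.
Local Open Scope ring_scope.

(** A graded R-module is a family of R-modules indexed by cohomological degree.
    Completeness [M ~ lim M / F_p M] is separation together with the convergence
    of every sequence whose [p]-th increment lies in [F_p]. *)
Record fgmod (R : realType) := FGMod {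
  gr :> int -> lmodType R;
  fil : forall m : int, nat -> set (gr m);
  fil_all : forall m (x : gr m), fil 0 x;
  fil_decr : forall m p (x : gr m), fil p.+1 x -> fil p x;
  fil_zero : forall m p, fil p (0 : gr m);
  fil_lin : forall m p c (x y : gr m), fil p x -> fil p y -> fil p (c *: x + y);
  fil_sep : forall m (x : gr m), (forall p, fil p x) -> x = 0;
  fil_compl : forall m (u : nat -> gr m),
    (forall p, fil p (u p.+1 - u p)) ->
    exists x : gr m, forall p, fil p (x - u p) }.

Record grdg (R : realType) := GrDg {
  dg_mod :> fgmod R;
  dif : forall m : int, {linear dg_mod m -> dg_mod (m + 1)};
  dif_fil : forall m p (x : dg_mod m), fil p x -> fil p (dif m x);
  dif2_fil : forall m p (x : dg_mod m),
    fil p x -> fil p.+1 (dif (m + 1) (dif m x)) }.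

Section Filtered.
Variables (R : realType) (A : fgmod R).

Definition hel : Type := {m : int & A m}.

Definition mkhel (m : int) (x : A m) : hel := Tagged (fun m => A m : Type) x.

(** Degree [m] component of a homogeneous element. *)
Definition at_deg (x : hel) (m : int) : A m :=
  tagged_as (mkhel (0 : A m)) x.

(** Limit for the topology of the filtration (unique, by [fil_sep]). *)
Definition fil_lim (m : int) (u : nat -> A m) : A m :=
  xget 0 [set s | forall p, exists N, forall n, (N <= n)%N -> fil p (u n - s)].

(** [[:: (k_1, a_1); ...; (k_n, a_n)]] stands for the element
    [j_{k_1,...,k_n} (x) a_1 (x) ... (x) a_n] of [cCx^¡(A)]. *)
Definition word : Type := seq (nat * hel).

Definition adeg (w : word) : int := \sum_(x <- w) tag x.2.

Fixpoint in_fil (ps : seq nat) (w : word) : Prop :=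
  match ps, w with
  | [::], [::] => True
  | p :: ps', x :: w' => fil p (tagged x.2) /\ in_fil ps' w'
  | _, _ => False
  end.

End Filtered.

Definition dif_hel (R : realType) (A : grdg R) (x : hel A) : hel A :=
  mkhel (dif A (tag x) (tagged x)).

(** The basis element [j_{k_1,...,k_n}] is the list [[:: k_1; ...; k_n]]. *)
Definition jdeg (k : seq nat) : int := - (sumn k)%:Z.

Definition ksign (R : realType) (z : int) : R := (-1) ^+ `|z|%N.

(** Koszul sign of the rearrangement of [x_1, ..., x_n], of degrees [d],
    into [x_{s 1}, ..., x_{s n}]; for [d = k] this is the sign of [s] restricted
    to the indices with [k_j] odd. *)
Definition koszul (R : realType) n (d : 'I_n -> int) (s : 'S_n) : R :=
  \prod_(i < n) \prod_(j < n | (i < j)%N && (s j < s i)%N)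
    ksign R (d (s i) * d (s j)).

(** [Sh_{q_1,...,q_p}]: increasing on each of the consecutive blocks. *)
Definition is_shuffle (q : seq nat) n (s : 'S_n) : bool :=
  [forall i : 'I_n, forall j : 'I_n,
    (i < j)%N && (reshape_index q i == reshape_index q j) ==> (s i < s j)%N].

Definition alpha (R : realType) (k : seq nat) : R :=
  \sum_(s : 'S_(sumn k) | is_shuffle k s) (-1) ^+ s.

(** A term [coef . (c'; c''_1, ..., c''_p)^{s^-1}] of [cCx^¡ o cCx^¡]. *)
Record dterm (R : realType) (n : nat) := DTerm {
  dcoef : R;
  dleft : seq nat;
  dright : seq (seq nat);
  dperm : 'S_n }.

Section Delta.
Variables (R : realType) (n p : nat) (k : n.-tuple nat).

(** [(q, s, k')]; then [k'' = k - k']. *)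
Definition split_index : finType :=
  (p.-tuple 'I_n.+1 * 'S_n * {ffun 'I_n -> 'I_(sumn k).+1})%type.

Definition split_ok (t : split_index) : bool :=
  let: (q, s, k') := t in
  [&& (\sum_(i < p) tnth q i == n)%N, is_shuffle (map val q) s
    & [forall j, (k' j <= tnth k j)%N]].

Definition split_term (t : split_index) : dterm R n :=
  let: (q, s, k') := t in
  let k'' j := (tnth k j - k' j)%N in
  let blocks' := reshape (map val q) [seq val (k' (s i)) | i <- enum 'I_n] in
  let blocks'' := reshape (map val q) [seq k'' (s i) | i <- enum 'I_n] in
  let beta := koszul R (fun j => (tnth k j)%:Z) s
    * (-1) ^+ (\sum_(i < n) k'' (s i) * \sum_(j < n | (i < j)%N) k' (s j))%N
    * \prod_(b <- blocks') alpha R b in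
  DTerm (beta / p`!%:R) (map sumn blocks') blocks'' s.

(** The terms of [Delta(j_k)] whose left factor has arity [p]. *)
Definition Delta : seq (dterm R n) := [seq split_term t | t in split_ok].

End Delta.

(** Infinitesimal decomposition: one of the right factors, the [i]-th one, is
    kept and the counit [eps], dual to [j_0], is applied to the other ones.  All
    these being [j_0] forces [p <= n + 1]. *)
Definition Delta1 (R : realType) (n : nat) (k : n.-tuple nat) :
    seq (nat * dterm R n) :=
  flatten [seq [seq (i, t) | t <- Delta R p k,
      i <- [seq i <- iota 0 p |
        all (pred1 [:: 0%N]) (take i (dright t) ++ drop i.+1 (dright t))]]
    | p <- iota 0 n.+2].

Section DeltaA.
Variables (R : realType) (A : fgmod R).

Definition wjs (w : word A) : seq nat := map fst w.

Definition wks (w : word A) : (size w).-tuple nat := [tuple of map fst (in_tuple w)].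

Definition wdeg (w : word A) : int := jdeg (wjs w) + adeg w.

(** [coef . (c'; w_1, ..., w_p)] in [cCx^¡(cCx^¡(A))]. *)
Record cterm := CTerm {
  ccoef : R;
  cleft : seq nat;
  cblocks : seq (word A) }.

(** [((c'; c''_1, ..., c''_p)^{s^-1}) (x) a]: the [a_j] are rearranged along [s],
    then each [c''_j] moves to the right past the [a]'s of the blocks [i < j]. *)
Definition cterm_of (w : word A) (t : dterm R (size w)) : cterm :=
  let a j := (tnth (in_tuple w) j).2 in
  let as_ := [seq a (dperm t i) | i <- enum 'I_(size w)] in
  let blocks : seq (word A) :=
    [seq zip b.1 b.2 | b <- zip (dright t) (reshape (map size (dright t)) as_)] in
  let past := \sum_(j < size blocks) \sum_(i < size blocks | (i < j)%N)
    jdeg (wjs (nth [::] blocks j)) * adeg (nth [::] blocks i) in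
  CTerm (dcoef t * koszul R (fun j => tag (a j)) (dperm t) * ksign R past)
    (dleft t) blocks.

Definition DeltaA (p : nat) (w : word A) : seq cterm :=
  [seq cterm_of t | t <- Delta R p (wks w)].

(** [coef . c' (x) (a_1, ..., a_i, c'' (x) (b_1, ...), a_{i+1}, ...)], with [ipre]
    and [ipost] carrying the [a]'s and the corresponding indices of [c'], [iidx]
    the index of [c'] at the distinguished place and [iin = c'' (x) (b_1, ...)]. *)
Record iterm := ITerm {
  icoef : R;
  ipre : word A;
  iidx : nat;
  iin : word A;
  ipost : word A }.

Definition iterm_of (i : nat) (t : cterm) : iterm :=
  let as_ b := flatten (map (map snd) b) in
  ITerm (ccoef t)
    (zip (take i (cleft t)) (as_ (take i (cblocks t))))
    (nth 0%N (cleft t) i)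
    (nth [::] (cblocks t) i)
    (zip (drop i.+1 (cleft t)) (as_ (drop i.+1 (cblocks t)))).

Definition Delta1A (w : word A) : seq iterm :=
  [seq iterm_of t.1 (cterm_of t.2) | t <- Delta1 R (wks w)].

(** [|c'|] *)
Definition ileftdeg (t : iterm) : int :=
  jdeg (wjs (ipre t) ++ iidx t :: wjs (ipost t)).

End DeltaA.

(** A graded map out of [cCx^¡(A)] is given by its values on the generators;
    [f w m] is the degree [m] component of [f(w)]. *)
Definition gmap (R : realType) (A B : fgmod R) : Type :=
  forall (w : word A) (m : int), B m.

HB.instance Definition _ (R : realType) (A B : fgmod R) :=
  gen_eqMixin (gmap A B).
HB.instance Definition _ (R : realType) (A B : fgmod R) :=
  gen_choiceMixin (gmap A B).

Section GmapLmod.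
Variables (R : realType) (A B : fgmod R).
Implicit Types f g h : gmap A B.

Definition gmap0 : gmap A B := fun w m => 0.
Definition gmapN f : gmap A B := fun w m => - f w m.
Definition gmapD f g : gmap A B := fun w m => f w m + g w m.
Definition gmapZ (c : R) f : gmap A B := fun w m => c *: f w m.

Lemma gmapP f g : (forall w m, f w m = g w m) -> f = g.
Proof. by move=> h; apply: functional_extensionality_dep => w;
  apply: functional_extensionality_dep => m. Qed.

Fact gmapDA : associative gmapD.
Proof. by move=> f g h; apply: gmapP => w m; rewrite /gmapD addrA. Qed.
Fact gmapDC : commutative gmapD.
Proof. by move=> f g; apply: gmapP => w m; rewrite /gmapD addrC. Qed.
Fact gmap0D : left_id gmap0 gmapD.
Proof. by move=> f; apply: gmapP => w m; rewrite /gmapD add0r. Qed.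
Fact gmapND : left_inverse gmap0 gmapN gmapD.
Proof. by move=> f; apply: gmapP => w m; rewrite /gmapD addNr. Qed.

HB.instance Definition _ :=
  GRing.isZmodule.Build (gmap A B) gmapDA gmapDC gmap0D gmapND.

Fact gmapZA a b f : gmapZ a (gmapZ b f) = gmapZ (a * b) f.
Proof. by apply: gmapP => w m; rewrite /gmapZ scalerA. Qed.
Fact gmap1Z : left_id 1 gmapZ.
Proof. by move=> f; apply: gmapP => w m; rewrite /gmapZ scale1r. Qed.
Fact gmapZDr : right_distributive gmapZ +%R.
Proof. by move=> c f g; apply: gmapP => w m; apply: scalerDr. Qed.
Fact gmapZDl f : {morph gmapZ^~ f : a b / a + b}.
Proof. by move=> a b; apply: gmapP => w m; apply: scalerDl. Qed.

HB.instance Definition _ :=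
  GRing.Zmodule_isLmodule.Build R (gmap A B) gmapZA gmap1Z gmapZDr gmapZDl.

End GmapLmod.

(** [Hom^r(cCx^¡(A), B)].  As [B] is complete, a filtered map out of the completed
    sum of the [cCx^¡(n) (x)_{S_n} A^{(x) n}] is a family of filtered multilinear
    maps of degree [r] compatible with the action of the symmetric groups.  The
    filtration of [j_{k_1..k_n} (x) a_1 (x) ... (x) a_n] is the sum of those of
    the [a_i], to which [j_{()} \in F_1] adds one when [n = 0]. *)
Record is_hom (R : realType) (A B : fgmod R) (r : int) (f : gmap A B) : Prop :=
  IsHom {
  hom_deg : forall w m, m != wdeg w + r -> f w m = 0;
  hom_lin : forall (u v : word A) (k : nat) (e : int) (c : R) (x y : A e) m,
    f (u ++ (k, mkhel (c *: x + y)) :: v) m =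
    c *: f (u ++ (k, mkhel x) :: v) m + f (u ++ (k, mkhel y) :: v) m;
  hom_sym : forall (u v : word A) (x y : nat * hel A) m,
    f (u ++ y :: x :: v) m =
    ksign R (x.1%:Z * y.1%:Z + tag x.2 * tag y.2) *: f (u ++ x :: y :: v) m;
  hom_fil : forall ps w m,
    in_fil ps w -> fil (sumn ps + nilp w) (f w m) }.

(** Value on [w] of a map of degree [r]. *)
Definition hval (R : realType) (A B : fgmod R) (r : int) (f : gmap A B)
  (w : word A) : hel B := mkhel (f w (wdeg w + r)).

Section Operators.
Variables (R : realType) (A : grdg R).

(** [d_B f], for [f] of degree [r]. *)
Definition post_dif (B : grdg R) (r : int) (f : gmap A B) : gmap A B :=
  fun w m => at_deg (dif_hel (hval r f w)) m.

(** [f (id o' d_A)] *)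
Definition pre_dif (B : fgmod R) (f : gmap A B) : gmap A B := fun w m =>
  \sum_(i < size w)
    let x := tnth (in_tuple w) i in
    ksign R (jdeg (wjs w) + adeg (take i w)) *:
    f (take i w ++ (x.1, dif_hel x.2) :: drop i.+1 w) m.

(** [f d^r], with [d^r = (id o_(1) g)(Delta_(1) o id_A)] the coderivation with
    projection the degree 1 map [g : cCx^¡(A) -> A]; [g] moves past [c'] and the
    [a]'s on its left. *)
Definition pre_coder (g : gmap A A) (B : fgmod R) (f : gmap A B) : gmap A B :=
  fun w m => \sum_(t <- Delta1A w)
    (icoef t * ksign R (ileftdeg t + adeg (ipre t))) *:
    f (ipre t ++ (iidx t, hval 1 g (iin t)) :: ipost t) m.

(** [sum (-1)^{|c'|} g(s^-1 c' o_i s^-1 c''; a)], the sum being over the terms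
    [c' o_i c''] of [Delta_(1)(c)]; [s^-1 c''] moves past the [a]'s on the left. *)
Definition quad (g : gmap A A) : gmap A A :=
  fun w m => \sum_(t <- Delta1A w)
    (ksign R (ileftdeg t) * icoef t * ksign R (adeg (ipre t))) *:
    g (ipre t ++ (iidx t, hval 1 g (iin t)) :: ipost t) m.

(** [theta^c(c) . a], where [theta^c(j_2) = 1] and [theta^c] vanishes on the other
    basis elements. *)
Definition curv (w : word A) (m : int) : A m :=
  if w is [:: (2%N, a)] then at_deg a m else 0.

End Operators.

(** [cCx_oo] is free on [s^-1 ker eps], so an action of it on [A] is the data of
    the operations of the generators [s^-1 j_k], [j_k <> j_0].  They are recorded
    as [act = gamma_A(iota o id_A) : cCx^¡(A) -> A], of degree 1, where [iota]
    vanishes on [j_0]; thus [act (j_k (x) a) = gamma_A(s^-1 j_k; a)].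

    [act_dif] is the compatibility of [gamma_A] with the predifferentials on the
    generator [s^-1 c]: its left-hand side is
    [d_A(gamma(s^-1 c; a)) - (-1)^{|s^-1 c|} sum +/- gamma(s^-1 c; .., d_A a_i, ..)]
    and its right-hand side is [gamma(d(s^-1 c); a)] with
    [d(s^-1 c) = theta^c(c) - sum (-1)^{|c'|} s^-1 c' o_i s^-1 c''].  For
    [c = j_2] this reads [1 + (s^-1 j_1) o (s^-1 j_1)]: the sign of [theta^c] is the
    one for which multiplication by [i] on the complex numbers is an action.

    [act_curv] is [d_A^2 = gamma_A(theta o id)], with
    [theta = - s^-2 Delta_(1)(j_0)]. *)
Record oo_alg (R : realType) := OoAlg {
  alg_mod :> grdg R;
  act : gmap alg_mod alg_mod;
  act_hom : is_hom 1 act;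
  act_iota : forall a m, act [:: (0%N, a)] m = 0;
  act_dif : forall w m, wjs w <> [:: 0%N] ->
    post_dif 1 act w m + pre_dif act w m = curv w m - quad act w m;
  act_curv : forall (a : hel alg_mod) m,
    at_deg (dif_hel (dif_hel a)) m = - quad act [:: (0%N, a)] m }.

Arguments act {R} o w m.

(** [f d_b], with [d_b = id o' d_A + d^r_iota] the predifferential of the bar
    construction. *)
Definition pre_bar (R : realType) (A : oo_alg R) (B : fgmod R) (f : gmap A B) :
  gmap A B := pre_dif f + pre_coder (act A) f.

(** [gamma_B(iota o phi) Delta_{BA}], an infinite sum over the arity [p] of the left
    factor. *)
Definition star (R : realType) (A B : oo_alg R) (phi : gmap A B) : gmap A B :=
  fun w m => fil_lim (fun P => \sum_(p < P) \sum_(t <- DeltaA p w)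
    ccoef t *: act B (zip (cleft t) [seq hval 0 phi b | b <- cblocks t]) m).

(** oo-morphisms [A ~> B], as algebraic twisting morphisms [cCx^¡(A) -> B], that is
    as projections on [B] of the morphisms of coalgebras between the bar
    constructions commuting with the predifferentials.  Their sums and multiples
    are those of [Hom^0(cCx^¡(A), B)]. *)
Definition oo_mor (R : realType) (A B : oo_alg R) : {pred gmap A B} :=
  [pred phi | `[< is_hom 0 phi /\
     post_dif 0 phi - pre_bar phi + star phi = 0 >]].

Arguments oo_mor {R} A B.

Section AQ.
Variables (R : realType) (A : oo_alg R) (N : grdg R).

(** An [A]-module structure on [N], on the generators [s^-1 c']:
    [mu u (k, y) v] is the action of [s^-1 c'] on the [a]'s of [u], then [y], then
    the [a]'s of [v], [c'] having as indices those of [u], [k] and those of [v];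
    zero for [c' = j_0], on which [iota] vanishes.  The identity operation of
    [cCx_oo] does not occur in the image of [iota]. *)
Variable mu : word A -> nat * hel N -> word A -> forall m : int, N m.

(** [delta^l_iota(f)], for [f] of degree [r], which moves past [s^-1 c'] and the
    [a]'s on its left. *)
Definition delta_l (r : int) (f : gmap A N) : gmap A N :=
  fun w m => \sum_(t <- Delta1A w)
    (icoef t * ksign R r * ksign R (r * (ileftdeg t + 1 + adeg (ipre t)))) *:
    mu (ipre t) (iidx t, hval r f (iin t)) (ipost t) m.

Definition partial_tau (r : int) (f : gmap A N) : gmap A N :=
  - (ksign R r *: pre_bar f) + delta_l r f.

Definition Z0_AQ : {pred gmap A N} :=
  [pred f | `[< is_hom 0 f /\ partial_tau 0 f = 0 >]].

End AQ.

Definition submod_iso (R : realType) (V W : lmodType R) (P : {pred V})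
    (Q : {pred W}) : Prop :=
  [/\ submod_closed P, submod_closed Q &
    exists2 Phi : {x : V | x \in P} -> {y : W | y \in Q}, bijective Phi &
      forall c x y z, sval z = c *: sval x + sval y ->
        sval (Phi z) = c *: sval (Phi x) + sval (Phi y)].

Lemma at_deg_mk (R : realType) (A : fgmod R) m (x : A m) : at_deg (mkhel x) m = x.
Proof. exact: (@tagged_asE _ (fun m => A m : Type) (mkhel (0 : A m)) x). Qed.

Lemma at_deg_neq (R : realType) (A : fgmod R) (x : hel A) m :
  tag x != m -> at_deg x m = 0.
Proof.
by rewrite /at_deg /tagged_as /= eq_sym; case: eqP.
Qed.

Lemma at_deg0 (R : realType) (A : fgmod R) e m : at_deg (mkhel (0 : A e)) m = 0.
Proof.
have [em|ne] := eqVneq e m; first by subst m; rewrite at_deg_mk.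
by rewrite at_deg_neq.
Qed.

Lemma at_deg_hval (R : realType) (A B : fgmod R) r (f : gmap A B) w m :
  is_hom r f -> at_deg (hval r f w) m = f w m.
Proof.
move=> hf; have [<-|ne] := eqVneq (wdeg w + r) m; first exact: at_deg_mk.
by rewrite at_deg_neq // (hom_deg hf) // eq_sym.
Qed.

Section DeltaLemmas.
Variable R : realType.

Lemma split_right_shape n p (k : n.-tuple nat) t : split_ok (p := p) (k := k) t ->
  let r := dright (split_term R t) in size r = p /\ sumn (map size r) = n.
Proof.
case: t => [[q s] k'] /= /and3P[/eqP sq _ _].
rewrite size_reshape size_map size_tuple; split=> //.
rewrite -/(shape _) reshapeKl ?size_map -?enumT ?size_enum_ord.
  by rewrite sumnE big_map big_tuple.
by rewrite sumnE big_map big_tuple sq.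
Qed.

Lemma split_left_size n p (k : n.-tuple nat) t :
  size (dleft (split_term R (t : split_index p k))) = p.
Proof. by case: t => [[q s] k'] /=; rewrite size_map size_reshape size_map size_tuple. Qed.

Lemma Delta1_sum n (k : n.-tuple nat) (V : nmodType) (F : nat * dterm R n -> V) :
  (forall p t i, split_ok (k := k) t -> (i < p)%N ->
     all (pred1 [:: 0%N]) (take i (dright (@split_term R n p k t)) ++
       drop i.+1 (dright (split_term R t))) ->
     p != 1%N -> F (i, split_term R t) = 0) ->
  \sum_(t <- Delta1 R k) F t =
  \sum_(t | split_ok (p := 1) (k := k) t) F (0%N, split_term R t).
Proof.
move=> H; rewrite /Delta1 big_flatten big_map /=.
have E p : \sum_(x <- [seq (i, t) | t <- Delta R p k, i <- [seq i <- iota 0 p |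
        all (pred1 [:: 0%N]) (take i (dright t) ++ drop i.+1 (dright t))]]) F x =
  \sum_(t | split_ok (p := p) (k := k) t)
    \sum_(i <- iota 0 p | all (pred1 [:: 0%N])
      (take i (dright (split_term R t)) ++ drop i.+1 (dright (split_term R t))))
      F (i, split_term R t).
  by rewrite big_allpairs_dep big_image /=; apply: eq_bigr => t _; rewrite big_filter.
have Z p : p != 1%N -> \sum_(x <- [seq (i, t) | t <- Delta R p k,
      i <- [seq i <- iota 0 p |
        all (pred1 [:: 0%N]) (take i (dright t) ++ drop i.+1 (dright t))]]) F x = 0.
  move=> p1; rewrite E big1 // => t tok; rewrite big_seq_cond big1 // => i.
  by rewrite mem_iota add0n => /andP[/andP[_ ip] al]; exact: (H p).
rewrite !big_cons Z // add0r [X in _ + X]big_seq [X in _ + X]big1 ?addr0; last first.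
  by move=> p; rewrite mem_iota => /andP[p2 _]; apply: Z; case: p p2 => [|[]].
rewrite E; apply: eq_bigr => t tok; rewrite big_cons big_nil /=.
have [sz _] := split_right_shape tok.
by rewrite take0 drop_oversize ?sz //= addr0.
Qed.

Variable A : fgmod R.

Lemma cterm_left (w : word A) t : cleft (@cterm_of R A w t) = dleft t.
Proof. by []. Qed.

Lemma cterm_shape (w : word A) p (t : split_index p (wks w)) : split_ok t ->
  map size (cblocks (cterm_of (split_term R t))) = map size (dright (split_term R t)).
Proof.
move=> tok; have [_ sh] := split_right_shape tok.
rewrite /cterm_of /=; set r := dright _ in sh *; set as_ := [seq (tnth (in_tuple w) (dperm (split_term R t) i)).2 | i <- enum 'I_(size w)].
have szas : size as_ = size w by rewrite size_map size_enum_ord.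
have sE : shape (reshape (map size r) as_) = map size r.
  by apply: reshapeKl; rewrite sh szas.
rewrite -map_comp.
move: (reshape _ as_) sE => x; elim: r x {sh} => [|b r IH] [|c x] //= [e1 e2].
by rewrite size_zip e1 minnn IH.
Qed.

Lemma iterm_nnil (w : word A) p i (t : split_index p (wks w)) : split_ok t ->
  (i < p)%N -> all (pred1 [:: 0%N]) (take i (dright (split_term R t)) ++
       drop i.+1 (dright (split_term R t))) -> p != 1%N ->
  let u := iterm_of i (cterm_of (split_term R t)) in
  nilp (ipre u) && nilp (ipost u) = false.
Proof.
move=> tok ip al p1.
have [szr _] := split_right_shape tok.
have shb := cterm_shape tok.
rewrite /iterm_of; cbn [ipre ipost]; rewrite cterm_left.
move: (cblocks _) shb => b shb.
have szl := split_left_size t.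
have S (x : seq (word A)) (y : seq (seq nat)) : map size x = map size y ->
    all (pred1 [:: 0%N]) y -> size (flatten (map (map snd) x)) = size y.
  elim: x y => [|c x IH] [|d y] //= [e1 e2] /andP[/eqP d0 ay].
  by rewrite size_cat size_map e1 d0 /= (IH y).
move: al; rewrite all_cat => /andP[al1 al2].
rewrite /nilp !size_zip !(size_take, size_drop) szl.
have -> := S _ _ _ al1; last by rewrite !map_take shb.
have -> := S _ _ _ al2; last by rewrite !map_drop shb.
rewrite size_take size_drop szr ip !minnn.
apply/negP => /andP[/eqP i0]; rewrite i0 subn_eq0 => p_le1.
by case/negP: p1; rewrite eqn_leq p_le1 (leq_ltn_trans _ ip).
Qed.

End DeltaLemmas.

Lemma enum_I1 : enum 'I_1 = [:: ord0].
Proof. by rewrite enum_ordSl enum_ord0. Qed.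

Lemma big_I1_gt (R : Type) (idx : R) op (F : 'I_1 -> R) (i : 'I_1) :
  \big[op/idx]_(j < 1 | (i < j)%N) F j = idx.
Proof. by rewrite big_pred0 // => j; rewrite (ord1 i) (ord1 j). Qed.

Lemma big_I1_lt (R : Type) (idx : R) op (F : 'I_1 -> R) (i : 'I_1) :
  \big[op/idx]_(j < 1 | (j < i)%N) F j = idx.
Proof. by rewrite big_pred0 // => j; rewrite (ord1 i) (ord1 j). Qed.

Section ArityOne.
Variable R : realType.

Lemma perm_I1 (s : 'S_1) : s = 1%g.
Proof. by apply/permP => i; rewrite [LHS]ord1 [RHS]ord1. Qed.

Lemma is_shuffle1 q (s : 'S_1) : is_shuffle q s.
Proof. by apply/forallP => i; apply/forallP => j; rewrite (ord1 i) (ord1 j). Qed.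

Lemma alpha1 : alpha R [:: 1%N] = 1.
Proof.
rewrite /alpha (big_pred1 (1%g : 'S_1)) ?odd_perm1 // => s /=.
by rewrite (perm_I1 s) eqxx is_shuffle1.
Qed.

Lemma ksign0 : ksign R 0 = 1. Proof. by rewrite /ksign expr0. Qed.

Lemma koszul1 (d : 'I_1 -> int) s : koszul R d s = 1.
Proof.
rewrite /koszul big1 // => i _; rewrite big_pred0 // => j.
by rewrite (ord1 i) (ord1 j).
Qed.

Lemma iterm_I1 (A : fgmod R) k (a : hel A) q s
    (k' : {ffun 'I_1 -> 'I_(sumn (wks [:: (k, a)])).+1}) :
  split_ok (p := 1) (k := wks [:: (k, a)]) (q, s, k') ->
  iterm_of 0 (cterm_of (split_term R ((q, s, k') : split_index 1 (wks [:: (k, a)])))) =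
  ITerm (alpha R [:: val (k' ord0)]) [::] (k' ord0) [:: ((k - k' ord0)%N, a)] [::].
Proof.
move=> /and3P[/eqP + _ _]; rewrite big_ord1.
have [x qx] : exists x, tval q = [:: x].
  by case: q => [[|x [|y q]] //= sz]; exists x.
rewrite (tnth_nth ord0) qx /= => q1.
have qE : map val q = [:: 1%N] by rewrite qx /= q1.
rewrite /iterm_of /cterm_of /split_term qE /= !koszul1 !enum_I1 /= (perm_I1 s) !perm1.
rewrite !big_ord1 big_seq1 !big_I1_gt !big_I1_lt muln0 expr0 ksign0 factS fact0 divr1 !mulr1 mul1r.
have -> : tnth (wks [:: (k, a)]) ord0 = k by rewrite (tnth_nth 0%N).
by rewrite (addn0 (k' ord0)).
Qed.

End ArityOne.

Section Cplx.
Variable R : realType.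

Definition cgr (m : int) : lmodType R :=
  match m with Posz 0 => Rcomplex R | _ => 'rV[R]_0 end.

Definition cfil (m : int) (p : nat) : set (cgr m) :=
  [set x | p = 0%N \/ x = 0].

Fact cfil_decr m p (x : cgr m) : cfil p.+1 x -> cfil p x.
Proof. by case=> // ->; right. Qed.

Fact cfil_lin m p c (x y : cgr m) : cfil p x -> cfil p y -> cfil p (c *: x + y).
Proof. by move=> [->|->] [p0|->]; [left|left|left|right; rewrite scaler0 addr0]. Qed.

Fact cfil_sep m (x : cgr m) : (forall p, cfil p x) -> x = 0.
Proof. by move=> /(_ 1%N) []. Qed.

Fact cfil_compl m (u : nat -> cgr m) :
  (forall p, cfil p (u p.+1 - u p)) -> exists x : cgr m, forall p, cfil p (x - u p).
Proof.
move=> hu; exists (u 1%N) => -[|p]; first by left.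
right; elim: p => [|p IH]; first exact: subrr.
have [//|e] := hu p.+1.
by move/eqP: e; rewrite subr_eq0 => /eqP ->.
Qed.

Definition Cmod : fgmod R := FGMod (gr := cgr)
  (fun m x => or_introl erefl) cfil_decr (fun m p => or_intror erefl)
  cfil_lin cfil_sep cfil_compl.

Definition cdif (m : int) : {linear cgr m -> cgr (m + 1)} := \0.

Definition Cdg : grdg R := GrDg (dg_mod := Cmod) (dif := cdif)
  (fun m p x _ => or_intror erefl) (fun m p x _ => or_intror erefl).

Definition mul_i (m : int) : cgr m -> cgr m :=
  match m with Posz 0 => fun z : R[i] => 'i%C * z | _ => id end.

(** [gamma_C]: multiplication by [i] for [s^-1 j_1], zero for the other
    generators. *)
Definition Cact : gmap Cdg Cdg := fun w m =>
  if w is [:: (1%N, z)] then mul_i (at_deg z m) else 0.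

(** [gamma^A_C] *)
Definition Cmodact (A : oo_alg R) (u : word A) (y : nat * hel Cdg) (v : word A)
    (m : int) : Cdg m :=
  if [&& nilp u, y.1 == 1%N & nilp v] then mul_i (at_deg y.2 m) else 0.

Lemma mul_i_lin m c (x y : cgr m) : mul_i (c *: x + y) = c *: mul_i x + mul_i y.
Proof.
case: m x y => [[|n]|n] //= x y.
rewrite mulrDr; congr (_ + _).
case: x => a b; apply/eqP; rewrite eq_complex /=; apply/andP; split; apply/eqP.
  by rewrite !mul0r !mul1r !sub0r mulrN.
by rewrite !mul0r !mul1r !add0r.
Qed.

Lemma mul_i0 m : mul_i (0 : cgr m) = 0.
Proof. by have := mul_i_lin (-1) (0 : cgr m) 0; rewrite scaler0 addr0 scaleN1r addNr. Qed.

Lemma mul_ii m (x : cgr m) : mul_i (mul_i x) = - x.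
Proof.
case: m x => [[|n]|n] /= x; last 2 first.
- by apply/rowP => -[].
- by apply/rowP => -[].
by rewrite mulrA -expr2 sqr_i mulN1r.
Qed.

Lemma Cact_cat (u v : word Cdg) x m : Cact (u ++ x :: v) m =
  if [&& nilp u, x.1 == 1%N & nilp v] then mul_i (at_deg x.2 m) else 0.
Proof.
case: u => [|a u] /=; last by case: u => [|b u]; case: a => [[|[|?]] ?].
by case: x => [[|[|k]] x]; case: v.
Qed.

Lemma at_deg_lin e m c (x y : Cdg e) :
  at_deg (mkhel (c *: x + y)) m = c *: at_deg (mkhel x) m + at_deg (mkhel y) m.
Proof.
have [em|ne] := eqVneq e m; first by subst m; rewrite !at_deg_mk.
by rewrite !at_deg_neq // scaler0 addr0.
Qed.

Fact Cact_hom : is_hom 1 Cact.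
Proof.
split.
- move=> w m; case: w => [|[[|[|k]] x] [|y w]] //=.
  rewrite /wdeg /adeg /jdeg big_seq1 /= => ne; rewrite at_deg_neq ?mul_i0 //.
  apply: contraNneq ne => <-; rewrite addn0.
  by rewrite addrAC addNr add0r.
- move=> u v k e c x y m; rewrite !Cact_cat /=.
  case: ifP => _; last by rewrite scaler0 addr0.
  by rewrite at_deg_lin mul_i_lin.
- move=> u v x y m; rewrite !Cact_cat /= !andbF.
  by rewrite scaler0.
- move=> ps w m; case: w => [|[[|[|k]] x] [|y w]] /=; try by right.
  case: ps => [|p [|? ?]] //=; rewrite ?addn0; last by case.
  move=> [[->|/= x0] _]; first by left.
  right; case: x x0 => e x /= ->.
  by rewrite at_deg0 mul_i0.
Qed.

Lemma Cpost r f : post_dif r (f : gmap Cdg Cdg) = 0.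
Proof. by apply: gmapP => w m; rewrite /post_dif /dif_hel /= at_deg0. Qed.

Lemma Cpre w m : pre_dif Cact w m = 0.
Proof.
rewrite /pre_dif big1 // => i _ /=; rewrite Cact_cat /=.
by rewrite /dif_hel /= at_deg0 mul_i0 if_same scaler0.
Qed.

Lemma Cact_size w m : size w != 1%N -> Cact w m = 0.
Proof. by case: w => [|[[|[|k]] x] [|y w]]. Qed.

Lemma quad_Cact w m : quad Cact w m = curv w m.
Proof.
rewrite /quad /Delta1A big_map Delta1_sum; last first.
  move=> p t i tok ip al p1.
  have := iterm_nnil tok ip al p1; cbv zeta.
  rewrite Cact_cat; case: ifP => [/and3P[-> _ ->] //|_ _].
  by rewrite scaler0.
have [sw|sw] := eqVneq (size w) 1%N; last first.
  have -> : curv w m = 0 by case: w sw => [|[[|[|[|k]]] x] [|y w]].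
  rewrite big1 // => t tok; rewrite Cact_cat.
  have [sz shp] := split_right_shape R tok.
  have := cterm_shape tok.
  set b := cblocks (cterm_of _) => shb.
  have sb : size (nth [::] b 0) = size w.
    move: (dright _) sz shp shb => -[|c [|? ?]] //= _ <-.
    by case: b => [|d [|? ?]] //= [->]; rewrite addn0.
  rewrite /iterm_of; cbn [fst snd iidx ipre ipost iin]; rewrite -/b.
  rewrite /hval Cact_size ?sb // at_deg0 mul_i0 if_same.
  by rewrite scaler0.
case: w sw => [|[k a] [|y w]] // _.
transitivity (\sum_(t : split_index 1 (wks [:: (k, a)]) | split_ok t)
    (if (t.2 ord0 == 1%N :> nat) && (k == 2%N) then at_deg a m else 0)).
  apply: eq_bigr => -[[q s] k'] tok.
  rewrite [(_, _).1]/= [(_, _).2]/= iterm_I1 // /ileftdeg.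
  cbn [icoef ipre iidx iin ipost]; rewrite Cact_cat; cbn [fst snd].
  rewrite (at_deg_hval _ _ Cact_hom) /= andbT.
  case: eqP => [->|_]; last by rewrite scaler0.
  rewrite alpha1 /adeg big_nil ksign0 !mulr1 /jdeg /ksign /= expr1.
  case: k {q s k' tok} => [|[|[|k]]] /=; rewrite ?mul_i0 ?scaler0 //.
  by rewrite mul_ii scalerN scaleN1r opprK.
have [k2|k2] := eqVneq k 2%N; last first.
  rewrite big1 => [|t _]; last by rewrite andbF.
  by case: k k2 => [|[|[|k]]].
subst k; pose k0 := wks [:: (2%N, a)].
pose q0 : 1.-tuple 'I_2 := [tuple ord_max].
pose f0 : {ffun 'I_1 -> 'I_3} := [ffun=> Ordinal (isT : (1 < 3)%N)].
pose t0 : split_index 1 k0 := (q0, 1%g : 'S_1, f0).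
have ok0 : split_ok t0.
  apply/and3P; split; first by rewrite big_ord1.
    exact: is_shuffle1.
  by apply/forallP => j; rewrite ffunE (ord1 j) (tnth_nth 0%N).
rewrite (bigD1 t0) //= ffunE /= big1 ?addr0 // => -[[q s] k'].
move=> /andP[tok ne]; case: eqP => //= k1; case/negP: ne; apply/eqP.
have [/eqP + _ _] := and3P tok; rewrite big_ord1 => q1.
rewrite /t0; congr (_, _, _); last first.
- by apply/ffunP => j; apply/val_inj; rewrite ffunE (ord1 j).
- exact: perm_I1.
by apply: eq_from_tnth => j; apply/val_inj; rewrite (ord1 j) /= q1.
Qed.

Fact Cact_dif w m : wjs w <> [:: 0%N] ->
  post_dif 1 Cact w m + pre_dif Cact w m = curv w m - quad Cact w m.
Proof. by move=> _; rewrite Cpost Cpre quad_Cact subrr addr0. Qed.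

Fact Cact_curv (a : hel Cdg) m :
  at_deg (dif_hel (dif_hel a)) m = - quad Cact [:: (0%N, a)] m.
Proof. by rewrite quad_Cact /= oppr0 /dif_hel /= at_deg0. Qed.

Definition Calg : oo_alg R := OoAlg (alg_mod := Cdg) (act := Cact)
  Cact_hom (fun _ _ => erefl) Cact_dif Cact_curv.

End Cplx.

Arguments Cmodact {R} A u y v m.

(* Main.v *)
Require Import Defs.
From mathcomp Require Import all_boot all_algebra.
From mathcomp Require Import reals.
From mathcomp Require Import boolp classical_sets.

(** A complex-valued twisting morphism and a cocycle satisfy the same equation:
    [d_C = 0], and since the only generator acting on [C] is the unary [s^-1 j_1],
    with the same action in [gamma_C] and [gamma^A_C], only the terms of [Delta]
    whose left factor has arity 1 contribute to [gamma_C(iota o phi) Delta] and to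
    [delta^l_iota(phi)].  Hence the quadratic-looking term is linear in [phi], and
    the isomorphism is the identity of [Hom^0(cCx^¡(A), C)]. *)

Set Implicit Arguments.
Unset Strict Implicit.
Unset Printing Implicit Defensive.

Import GRing.Theory.

Local Open Scope ring_scope.

Section FilteredMaps.
Variables (R : realType) (A B : fgmod R).

(** Separation of the filtration makes limits unique. This evaluates the infinite sum in [star] once
    its partial sums are constant. *)
Lemma fil_lim_stationary m (u : nat -> B m) s N :
  (forall n, (N <= n)%N -> u n = s) -> fil_lim u = s.
Proof.
move=> us; rewrite /fil_lim; case: xgetP => [x _ xlim|/(_ s) nlim].
  apply/esym/eqP; rewrite -subr_eq0; apply/eqP; apply: fil_sep => p.
  have [M HM] := xlim p; rewrite -(us (maxn M N)) ?leq_maxr //.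
  by apply: HM; rewrite leq_maxl.
(* The default value of [xget] cannot occur, since [s] itself is a limit. *)
exfalso; apply: nlim => p; exists N => n /us ->; rewrite subrr.
exact: fil_zero.
Qed.

Lemma is_hom0 r : is_hom r (0 : gmap A B).
Proof.
split=> [//|u v k e c x y m|u v x y m|ps w m _].
- by rewrite scaler0 addr0.
- by rewrite scaler0.
- exact: fil_zero.
Qed.

Lemma is_homZD r c (f g : gmap A B) :
  is_hom r f -> is_hom r g -> is_hom r (c *: f + g).
Proof.
move=> hf hg; split=> [w m ne|u v k e a x y m|u v x y m|ps w m hw].
- change (c *: f w m + g w m = 0).
  by rewrite (hom_deg hf) // (hom_deg hg) // scaler0 addr0.
- change (c *: f (u ++ (k, mkhel (a *: x + y)) :: v) m
      + g (u ++ (k, mkhel (a *: x + y)) :: v) m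
    = a *: (c *: f (u ++ (k, mkhel x) :: v) m + g (u ++ (k, mkhel x) :: v) m)
      + (c *: f (u ++ (k, mkhel y) :: v) m + g (u ++ (k, mkhel y) :: v) m)).
  rewrite (hom_lin hf) (hom_lin hg) !scalerDr !scalerA (mulrC a c) -!addrA.
  by congr (_ + _); rewrite addrCA.
- change (c *: f (u ++ y :: x :: v) m + g (u ++ y :: x :: v) m
    = ksign R (x.1%:Z * y.1%:Z + tag x.2 * tag y.2)
      *: (c *: f (u ++ x :: y :: v) m + g (u ++ x :: y :: v) m)).
  rewrite (hom_sym hf) (hom_sym hg) scalerDr !scalerA.
  by rewrite (mulrC c).
- change (fil (sumn ps + nilp w) (c *: f w m + g w m)).
  by apply: fil_lin; [exact: (hom_fil hf) | exact: (hom_fil hg)].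
Qed.

End FilteredMaps.

Section BarPrecomposition.
Variables (R : realType) (A : oo_alg R) (B : fgmod R).

Lemma pre_bar0 : pre_bar (0 : gmap A B) = 0.
Proof.
apply: gmapP => w m; transitivity (pre_dif (0 : gmap A B) w m
  + pre_coder (act A) (0 : gmap A B) w m) => //.
by rewrite /pre_dif /pre_coder !big1 ?addr0 // => t _; rewrite scaler0.
Qed.

(** Each term of [pre_dif] and [pre_coder] evaluates the map once, with a coefficient that does not
    involve it. *)
Lemma pre_barZD c (f g : gmap A B) :
  pre_bar (c *: f + g) = c *: pre_bar f + pre_bar g.
Proof.
apply: gmapP => w m.
change (pre_dif (c *: f + g) w m + pre_coder (act A) (c *: f + g) w m =
  c *: (pre_dif f w m + pre_coder (act A) f w m)
  + (pre_dif g w m + pre_coder (act A) g w m)).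
rewrite scalerDr addrACA; congr (_ + _); rewrite [in RHS]scaler_sumr -big_split /=;
  by apply: eq_bigr => t _; rewrite [LHS]scalerDr !scalerA (mulrC c).
Qed.

End BarPrecomposition.

Section ComplexTarget.
Variables (R : realType) (A : oo_alg R).
Local Notation C := (Calg R).

Lemma post_dif_C r (f : gmap A C) : post_dif r f = 0.
Proof. by apply: gmapP => w m; rewrite /post_dif /dif_hel /= at_deg0. Qed.

Lemma size_cblocks (w : word A) p (t : split_index p (wks w)) : split_ok t ->
  size (cblocks (cterm_of (split_term R t))) = p.
Proof.
move=> tok; have [sr _] := split_right_shape R tok.
by rewrite -(size_map size) cterm_shape // size_map sr.
Qed.

Lemma arity_one_term (w : word A) (t : split_index 1 (wks w)) : split_ok t ->
  exists l b, cleft (cterm_of (split_term R t)) = [:: l] /\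
              cblocks (cterm_of (split_term R t)) = [:: b].
Proof.
move=> /size_cblocks; have := split_left_size R t; rewrite cterm_left.
case: (dleft _) => [|l [|? ?]] // _; case: (cblocks _) => [|b [|? ?]] // _.
by exists l; exists b.
Qed.

(** The common value of [delta_l] and [star] on degree 0 maps to [C]. For [p = 1] the lists
    [cleft u] and [cblocks u] have a single entry, read off by [nth]. *)
Definition arity_one_part (f : gmap A C) : gmap A C := fun w m =>
  \sum_(t : split_index 1 (wks w) | split_ok t)
    let u := cterm_of (split_term R t) in
    ccoef u *: (if nth 0%N (cleft u) 0 == 1%N
                then mul_i (f (nth [::] (cblocks u) 0) m) else 0).

Lemma delta_l_C (f : gmap A C) : is_hom 0 f ->
  delta_l (Cmodact A) 0 f = arity_one_part f.
Proof.
move=> hf; apply: gmapP => w m.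
rewrite /delta_l /Delta1A big_map Delta1_sum; last first.
  (* For [p != 1], each right factor other than the [i]-th is [j_0] and carries one input, so [ipre]
     or [ipost] is nonempty and [Cmodact] vanishes. *)
  move=> p t i tok ip al p1; have := iterm_nnil tok ip al p1; cbv zeta.
  rewrite /Cmodact; case: ifP => [/and3P[-> _ ->] //|_ _].
  by rewrite scaler0.
apply: eq_bigr => t tok; have [l [b [El Eb]]] := arity_one_term tok.
rewrite /iterm_of /Cmodact; cbn [fst snd icoef ipre iidx iin ipost].
rewrite El Eb /= mul0r ksign0 !mulr1 andbT.
by rewrite (at_deg_hval _ _ hf).
Qed.

(** The word acted on has one letter, and [hval] loses nothing because [f] has degree 0. *)
Lemma act_arity_one (f : gmap A C) w m (t : split_index 1 (wks w)) :
  is_hom 0 f -> split_ok t ->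
  let u := cterm_of (split_term R t) in
  act C (zip (cleft u) [seq hval 0 f b | b <- cblocks u]) m =
  if nth 0%N (cleft u) 0 == 1%N
  then mul_i (f (nth [::] (cblocks u) 0) m) else 0.
Proof.
move=> hf /arity_one_term[l [b [El Eb]]]; rewrite /= -(at_deg_hval _ _ hf).
by move: El Eb => /= -> ->; case: l => [|[|l]].
Qed.

Lemma star_C (f : gmap A C) : is_hom 0 f -> star f = arity_one_part f.
Proof.
move=> hf; apply: gmapP => w m.
(* From [P = 2] on, the partial sum includes [p = 1], the only arity that contributes. *)
rewrite /star; apply: (@fil_lim_stationary _ _ _ _ _ 2) => -[|[|n]] // _.
rewrite !big_ord_recl [X in _ + (_ + X)]big1 ?addr0; last first.
  move=> i _; rewrite /DeltaA /Delta big_map big_image /= big1 // => t tok.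
  rewrite Cact_size ?scaler0 // size_zip size_map size_cblocks //.
  by rewrite split_left_size minnn.
rewrite /DeltaA /Delta big_map [X in _ + X]big_map !big_image big1 ?add0r.
  by apply: eq_bigr => t tok; congr (_ *: _); exact: act_arity_one.
(* What remains is [p = 0]: the empty word acts as zero. *)
move=> t _; rewrite [act _ _ _]Cact_size ?scaler0 // size_zip cterm_left.
by rewrite split_left_size min0n.
Qed.

Lemma arity_one_part0 : arity_one_part 0 = 0.
Proof.
apply: gmapP => w m; rewrite /arity_one_part big1 // => t _ /=.
by rewrite [X in if _ then X else _]mul_i0 if_same scaler0.
Qed.

(** Multiplication by [i] on the complex numbers is linear over the reals. *)
Lemma arity_one_partZD c (f g : gmap A C) :
  arity_one_part (c *: f + g) = c *: arity_one_part f + arity_one_part g.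
Proof.
apply: gmapP => w m; rewrite /arity_one_part.
transitivity (c *: arity_one_part f w m + arity_one_part g w m) => //.
rewrite [in RHS]scaler_sumr -big_split /=; apply: eq_bigr => t _.
case: ifP => _; last by rewrite !scaler0 addr0.
by rewrite [X in _ *: X]mul_i_lin scalerDr !scalerA (mulrC c).
Qed.

(** Both sides of the equation are linear in [f], which gives closure under linear combinations. *)
Lemma mem_Z0_C (f : gmap A C) : f \in Z0_AQ (Cmodact A) <->
  is_hom 0 f /\ pre_bar f = arity_one_part f.
Proof.
split=> [/asboolP[hf]|[hf e]]; last (apply/asboolP; split=> //; move: e);
  rewrite /partial_tau delta_l_C // ksign0 scale1r addrC => /eqP.
  by rewrite subr_eq0 => /eqP.
by move=> /eqP ->; rewrite subrr.
Qed.

(** As [d_C = 0], both conditions become [- pre_bar f + arity_one_part f = 0]. *)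
Lemma Z0_C_oo_mor : Z0_AQ (Cmodact A) =i oo_mor A C.
Proof.
move=> f; apply: asbool_equiv_eq; split=> -[hf e]; split=> //; move: e;
  by rewrite /partial_tau post_dif_C star_C // delta_l_C // ksign0 scale1r sub0r.
Qed.

Lemma Z0_C_submod : submod_closed (Z0_AQ (Cmodact A)).
Proof.
split.
  apply/mem_Z0_C; split; first exact: is_hom0.
  by rewrite [LHS]pre_bar0 arity_one_part0.
move=> c f g /mem_Z0_C[hf ef] /mem_Z0_C[hg eg].
apply/mem_Z0_C; split; first exact: is_homZD.
by rewrite [LHS]pre_barZD arity_one_partZD ef eg.
Qed.

End ComplexTarget.

(** The bijection keeps the underlying element and only exchanges the membership proof. Closure of
    [Q] is transported from [P], so the twisting equation is never shown linear directly. *)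
Lemma submod_iso_eq (R : realType) (V : lmodType R) (P Q : {pred V}) :
  submod_closed P -> P =i Q -> submod_iso P Q.
Proof.
move=> [P0 PZD] PQ; split=> //.
  by split=> [|c x y]; rewrite -!PQ //; apply: PZD.
have PtoQ x : x \in P -> x \in Q by rewrite PQ.
have QtoP x : x \in Q -> x \in P by rewrite PQ.
exists (fun x => exist _ (sval x) (PtoQ _ (svalP x))) => //.
exists (fun x => exist _ (sval x) (QtoP _ (svalP x))) => x; exact: val_inj.
Qed.

Theorem proposition5p3 (R : realType) (A : oo_alg R) :
  submod_iso (Z0_AQ (Cmodact A)) (oo_mor A (Calg R)).
Proof. exact: submod_iso_eq (@Z0_C_submod R A) (@Z0_C_oo_mor R A). Qed.
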